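(* Let $k$ be an algebraically closed field of characteristic $p\geq 3$ and let $\mathfrak g=\mathfrak g_{\overline 0}\oplus\mathfrak g_{\overline 1}$ be a finite-dimensional Lie superalgebra over $k$. Then, as an affine subvariety of $\mathfrak g_{\overline 1}$, $$\mathcal X_{\mathfrak g}(k)\cong\{x\in\mathfrak g_{\overline 1}:[x,x]=0\}.$$
   Context: $\operatorname{H}^\bullet(\mathfrak g,k)=\operatorname{Ext}^\bullet_{U(\mathfrak g)}(k,k)$ is the cohomology of the Koszul complex $(\Lambda_s(\mathfrak g^* ),\partial)$, where: $\Lambda_s(\mathfrak g^* )\cong\Lambda(\mathfrak g_{\overline 0}^* )\otimes S(\mathfrak g_{\overline 1}^* )$ is the superexterior algebra, i.e. the free graded-commutative ($ab=(-1)^{\overline a\,\overline b+\deg(a)\deg(b)}ba$) $\mathbb Z\times\mathbb Z/2$-graded superalgebra generated by $\mathfrak g^*$ in $\mathbb Z$-degree $1$; $\partial$ is the derivation ($\partial(ab)=\partial(a)b+(-1)^{\deg a}a\,\partial(b)$) whose restriction $\mathfrak g^*\to\Lambda_s^2(\mathfrak g^* )\cong[\Lambda_s^2(\mathfrak g)]^*$ is the transpose of the Lie bracket $\Lambda^2_s(\mathfrak g)\to\mathfrak g$. For a $k$-vector space $W$, $W^{(1)}$ is $W$ with $\lambda\in k$ acting as $\lambda^{1/p}$ (Frobenius twist), and $W[p]$ means $W$ placed in $\mathbb Z$-degree $p$. The $p$-power map on $S(\mathfrak g_{\overline 1}^* )\subseteq\Lambda_s(\mathfrak g^* )$ has image consisting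 of cocycles, and so induces a homomorphism of graded superalgebras $\varphi:S(\mathfrak g_{\overline 1}^*[p])^{(1)}\to\operatorname{H}^\bullet(\mathfrak g,k)$, sending $f\in\mathfrak g_{\overline 1}^*$ to the class of $f^p$. Let $J=\ker\varphi$ and $\mathcal X_{\mathfrak g}(k):=\operatorname{Max}\big(S(\mathfrak g_{\overline 1}^*[p])^{(1)}/J\big)$ (maximal ideal spectrum). Since $S(\mathfrak g_{\overline 1}^* )^{(1)}$ has the same underlying ring as $S(\mathfrak g_{\overline 1}^* )$, its maximal ideal spectrum is identified with $\mathfrak g_{\overline 1}$ ($x\in\mathfrak g_{\overline 1}$ corresponding to the ideal of polynomial functions vanishing at $x$), so $\mathcal X_{\mathfrak g}(k)$ identifies with the zero locus of $J$ in $\mathfrak g_{\overline 1}$. The isomorphism in the claim is this identification. *)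

(* Defs.v *)
From HB Require Import structures.
From mathcomp Require Import all_boot all_order all_algebra.
From mathcomp Require Import boolp classical_sets functions mpoly.

Set Implicit Arguments.
Unset Strict Implicit.
Unset Printing Implicit Defensive.

Import GRing.Theory.

Local Open Scope ring_scope.

(* The parity group Z/2 is [bool] with [addb].  These are the axioms of a Lie
   superalgebra in characteristic different from 2.  [sbracket_cube] follows
   from [sbracket_jacobi] unless the characteristic is 3, where it is part of
   the definition (without it the Koszul differential does not square to 0). *)
Record lieSuperalgebra (k : fieldType) := LieSuperalgebra {
  carrier :> vectType k;
  component : bool -> {vspace carrier};
  sbracket : carrier -> carrier -> carrier;
  component_cap : (component false :&: component true)%VS = 0%VS;
  component_add : (component false + component true)%VS = fullv;
  sbracket_linearr : forall x, linear (sbracket x);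
  sbracket_linearl : forall y, linear (sbracket^~ y);
  sbracket_graded : forall (a b : bool) x y,
    x \in component a -> y \in component b ->
    sbracket x y \in component (a (+) b);
  sbracket_skew : forall (a b : bool) x y,
    x \in component a -> y \in component b ->
    sbracket x y = - ((-1) ^+ (a && b) *: sbracket y x);
  sbracket_jacobi : forall (a b : bool) x y z,
    x \in component a -> y \in component b ->
    sbracket x (sbracket y z) =
      sbracket (sbracket x y) z
      + (-1) ^+ (a && b) *: sbracket y (sbracket x z);
  sbracket_cube : forall x,
    x \in component true -> sbracket x (sbracket x x) = 0
}.

Section SuperExterior.
Variables (k : fieldType) (m n : nat).

(* The free graded-commutative algebra on even generators x_i (i < m) and odd
   generators y_j (j < n) of Z-degree 1, as Lambda(x) (x) S(y): the element a
   stands for \sum_S x_S * a S, where x_S is the product of the x_i, i in S, in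
   increasing order, and a S is a polynomial in the y_j.  The x_i anticommute
   with each other and with the y_j, and the y_j commute with each other. *)
Definition superext := {ffun {set 'I_m} -> {mpoly k[n]}}.
HB.instance Definition _ := GRing.Lmodule.on superext.

Implicit Types (a b : superext) (S T U : {set 'I_m}) (P : {mpoly k[n]}).

Definition inversions S T : nat :=
  #|[set st : 'I_m * 'I_m | [&& st.1 \in S, st.2 \in T & (st.2 < st.1)%N]]|.

(* P(-y) if t is odd: the effect on P of moving it past t of the x_i *)
Definition ytwist (t : nat) P : {mpoly k[n]} :=
  P \mPo [tuple (-1) ^+ t *: 'X_j | j < n].

Definition smul a b : superext :=
  [ffun U : {set 'I_m} => \sum_(S in powerset U)
     (-1) ^+ inversions S (U :\: S) *: (ytwist #|U :\: S| (a S) * b (U :\: S))].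

(* the inclusion of S(y) *)
Definition sym_incl P : superext :=
  [ffun S : {set 'I_m} => if S == finset.set0 then P else 0].

Definition xgen (i : 'I_m) : superext :=
  [ffun S : {set 'I_m} => (S == finset.set1 i)%:R].
Definition ygen (j : 'I_n) : superext := sym_incl 'X_j.

(* the left partial superderivatives with respect to x_i and to y_j; both have
   Z-degree -1, and the latter is odd *)
Definition dx (i : 'I_m) a : superext :=
  [ffun S : {set 'I_m} =>
     if i \in S then 0
     else (-1) ^+ #|[set s in S | (s < i)%N]| *: a (i |: S)%SET].
Definition dy (j : 'I_n) a : superext :=
  [ffun S : {set 'I_m} => (-1) ^+ #|S| *: (a S)^`M(j)].

End SuperExterior.

Section Koszul.
Local Open Scope classical_set_scope.
Variables (k : fieldType) (g : lieSuperalgebra k).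

Local Notation g0 := (component g false).
Local Notation g1 := (component g true).
Local Notation "[ x , y ]" := (sbracket x y).

Definition ebasis := vbasis g0.
Definition obasis := vbasis g1.
Local Notation e := (tnth ebasis).
Local Notation o := (tnth obasis).

(* the basis of g^* dual to the basis ebasis ++ obasis of g *)
Definition edual (i : 'I_(\dim g0)) : g -> k :=
  coord (cat_tuple ebasis obasis) (lshift _ i).
Definition odual (j : 'I_(\dim g1)) : g -> k :=
  coord (cat_tuple ebasis obasis) (rshift _ j).

(* Lambda_s(g^* ), where xgen i stands for edual i and ygen j for odual j *)
Local Notation cochain := (superext k (\dim g0) (\dim g1)).

(* The transpose of the bracket, g^* -> Lambda_s^2(g^* ) = Lambda_s^2(g)^*.
   The product f h takes on the product u v the value f u * h v + f v * h u if
   u and v are odd, and f u * h v - f v * h u otherwise; so y_j ^ 2 takes the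
   value 2 on the square of o_j, whence the division by 2. *)
Definition cobracket (f : g -> k) : cochain :=
    \sum_(i < \dim g0) \sum_(j < \dim g0 | (i < j)%N)
       f [e i, e j] *: smul (xgen _ _ i) (xgen _ _ j)
  + \sum_(i < \dim g0) \sum_(j < \dim g1)
       f [e i, o j] *: smul (xgen _ _ i) (ygen _ _ j)
  + \sum_(i < \dim g1) \sum_(j < \dim g1 | (i < j)%N)
       f [o i, o j] *: smul (ygen _ _ i) (ygen _ _ j)
  + \sum_(j < \dim g1)
       (f [o j, o j] / 2%:R) *: smul (ygen _ _ j) (ygen _ _ j).

(* The derivation extending cobracket, by the chain rule.  Each term is of the
   form (element z of Z-degree 2 and parity e) * (superderivative of Z-degree
   -1 and parity e), hence satisfies d(ab) = d(a) b + (-1)^(deg a) a d(b). *)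
Definition koszul_diff (a : cochain) : cochain :=
    \sum_(i < \dim g0) smul (cobracket (edual i)) (dx i a)
  + \sum_(j < \dim g1) smul (cobracket (odual j)) (dy j a).

Definition cocycle : set cochain := [set a | koszul_diff a = 0].

Definition coh_class (a : cochain) : set cochain :=
  [set b | exists c, b - a = koszul_diff c].

(* H(g, k), the set of cosets in cocycle of the image of koszul_diff *)
Definition cohomology : set (set cochain) := coh_class @` cocycle.

(* S(g_1^* ), where 'X_j stands for odual j.  The Frobenius twist and the shift
   in degree change neither the underlying ring nor its ideals. *)
Local Notation odd_sym := {mpoly k[\dim g1]}.

(* phi, which takes its values in [cohomology] if p is the characteristic *)
Definition power_map (p : nat) (P : odd_sym) : set cochain :=
  coh_class (sym_incl _ (P ^+ p)).

Definition power_ker (p : nat) : set odd_sym :=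
  [set P | power_map p P = coh_class 0].

Definition max_ideal (M : set odd_sym) : Prop :=
  idealr_closed (mem M) /\
  forall I : set odd_sym, idealr_closed (mem I) -> M `<=` I -> I = M.

(* The maximal spectrum of S(g_1^* )/J, J = power_ker p, whose elements are
   given by their preimages in S(g_1^* ). *)
Definition cohvar (p : nat) : set (set odd_sym) :=
  [set M | max_ideal M /\ power_ker p `<=` M].

(* the ideal of the polynomial functions on g_1 that vanish at x *)
Definition point_ideal (x : g) : set odd_sym :=
  [set P | P.@[fun j => odual j x] = 0].

End Koszul.

(* Main.v *)
Require Import Defs.
From HB Require Import structures.
From mathcomp Require Import all_boot all_order all_algebra.
From mathcomp Require Import boolp classical_sets functions mpoly.

(** Let J be the kernel of the p-power map.  If [x, x] = 0, then sending a cochain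
    to the value at x of its component in S(g_1^* ) kills the coboundaries, because
    it is multiplicative and maps the differential of f in g^* to f([x, x]) / 2; so
    every P in J, for which P^p is a coboundary, vanishes at x.  Conversely, for f in
    g_0^* write df = q + omega with q in S^2(g_1^* ) and omega in Lambda^2(g_0^* ).
    As q and omega commute and omega^p = 0, we have q^p = (df)^p = d(f (df)^(p-1)),
    which puts q in J; and q(x) = f([x, x]) / 2.  Hence the zero locus of J is
    {x : [x, x] = 0}, and the Nullstellensatz identifies the maximal ideals that
    contain J with its points. *)

Set Implicit Arguments.
Unset Strict Implicit.
Unset Printing Implicit Defensive.

Import GRing.Theory.

Local Open Scope ring_scope.

(** * The weak Nullstellensatz *)

(** The equality d(f (df)^(p-1)) = (df)^p rests on d(df) = 0 for f in the dual of g_0, which is the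
    Jacobi identity in two components, one for three even arguments and one for an even and two odd
    ones. There is no mixed part in df because f vanishes on [g_0, g_1]. And omega^p = 0 because
    omega is a sum of commuting multiples of products x_a x_b, each of square zero, and the p-th
    power is additive on such sums in characteristic p. Since the differential is given by the chain
    rule, the Leibniz rule has to be derived; products that begin with a generator suffice for
    computing d(f (df)^r). The Nullstellensatz goes by induction on the number of variables. It also
    asks that a given b outside the ideal be nonzero at the common zero, so that the leading
    coefficients met during elimination can be kept from vanishing. *)

Definition prime_ideal (R : comNzRingType) (Q : R -> Prop) : Prop :=
  [/\ Q 0, ~ Q 1, (forall a u v, Q u -> Q v -> Q (a * u + v))
    & (forall u v, Q (u * v) -> Q u \/ Q v)].

Section PrimeIdeal.
Variables (R : comNzRingType) (Q : R -> Prop).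
Hypothesis Qprime : prime_ideal Q.

Lemma prime_ideal0 : Q 0. Proof. by case: Qprime. Qed.

Lemma prime_idealD u v : Q u -> Q v -> Q (u + v).
Proof. by case: Qprime => _ _ QD _ Qu Qv; rewrite -[u]mul1r; apply: QD. Qed.

Lemma prime_idealMl a u : Q u -> Q (a * u).
Proof. by case: Qprime => Q0 _ QD _ Qu; rewrite -[_ * _]addr0; apply: QD. Qed.

Lemma prime_idealMr a u : Q u -> Q (u * a).
Proof. by rewrite mulrC; apply: prime_idealMl. Qed.

Lemma prime_idealB u v : Q u -> Q v -> Q (u - v).
Proof.
by move=> Qu Qv; apply: prime_idealD => //; rewrite -mulN1r; apply: prime_idealMl.
Qed.

Lemma prime_idealP u v : Q (u * v) -> Q u \/ Q v.
Proof. by case: Qprime => _ _ _; apply. Qed.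

Lemma prime_ideal_sum (I : Type) (r : seq I) (P : pred I) (F : I -> R) :
  (forall i, P i -> Q (F i)) -> Q (\sum_(i <- r | P i) F i).
Proof.
by move=> QF; elim/big_ind: _ => //; [apply: prime_ideal0 | apply: prime_idealD].
Qed.

Lemma prime_idealX u n : Q (u ^+ n) -> Q u.
Proof.
elim: n => [|n IH]; first by rewrite expr0; case: Qprime.
by rewrite exprS => /prime_idealP[].
Qed.

Lemma prime_ideal_preim (S : comNzRingType) (f : {rmorphism S -> R}) :
  prime_ideal (fun u => Q (f u)).
Proof.
case: Qprime => Q0 Q1 QD QM; split; rewrite ?rmorph0 ?rmorph1 //.
  by move=> a u v Qu Qv; rewrite rmorphD rmorphM; apply: QD.
by move=> u v; rewrite rmorphM; apply: QM.
Qed.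

End PrimeIdeal.

Section Extension.
Variables (R : idomainType) (Q : {poly R} -> Prop).
Hypothesis Qprime : prime_ideal Q.

Let q (r : R) := Q r%:P.
(** The extended ideal q R[X], which lies inside [Q]. *)
Let coefs_in_q (P : {poly R}) := forall i, q P`_i.

Let qprime : prime_ideal q.
Proof. exact: (prime_ideal_preim Qprime (polyC : {rmorphism R -> {poly R}})). Qed.

Let coefs_in_qW P : coefs_in_q P -> Q P.
Proof.
move=> qP; rewrite -[P]coefK poly_def; apply: prime_ideal_sum => // i _.
by rewrite -mul_polyC; apply: prime_idealMr => //; apply: qP.
Qed.

(** Take [F] in [I] of least size outside q R[X]. Were its leading coefficient in [q], its leading
    term would lie in q R[X], hence in [I]; subtracting it would leave an element of [I] of smaller
    size, so in q R[X], and then [F] itself would be in q R[X]. *)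
Let min_lead_coef (I : {poly R} -> Prop) :
    (forall u v, I u -> I v -> I (u - v)) -> (forall u, Q u -> I u) ->
    (exists2 P, I P & ~ coefs_in_q P) ->
  exists F, [/\ I F, ~ q (lead_coef F) &
    forall P, I P -> (size P < size F)%N -> coefs_in_q P].
Proof.
move=> IB QI [P0 IP0 nP0].
have ex_size : exists n, `[< exists P, [/\ I P, ~ coefs_in_q P & size P = n] >].
  by exists (size P0); apply/asboolP; exists P0.
have [n /asboolP[F [IF nF sF]] minF] := ex_minnP ex_size.
have {}minF P : I P -> (size P < size F)%N -> coefs_in_q P.
  move=> IP; rewrite sF ltnNge => /negP sP; apply: contrapT => nP.
  by apply/sP/minF/asboolP; exists P.
exists F; split=> // qF; apply: (nF).
have F_neq0 : F != 0.
  by apply/eqP => F0; apply: nF => i; rewrite F0 coef0; apply: (prime_ideal0 qprime).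
pose T := lead_coef F *: 'X^((size F).-1).
have qT : coefs_in_q T.
  by move=> i; rewrite /T coefZ; apply: (prime_idealMr qprime).
have IFT : coefs_in_q (F - T).
  apply: minF; first by apply: IB => //; apply/QI/coefs_in_qW.
  have s_gt0 : (0 < size F)%N by rewrite size_poly_gt0.
  rewrite -[X in (_ < X)%N](prednK s_gt0) ltnS; apply/leq_sizeP => j.
  rewrite leq_eqVlt /T coefB coefZ coefXn => /predU1P[<-|lt_j].
    by rewrite eqxx mulr1 /lead_coef subrr.
  by rewrite gtn_eqF // mulr0 subr0 nth_default // -[X in (X <= _)%N](prednK s_gt0).
by move=> i; rewrite -[F](subrK T) coefD; apply: prime_idealD.
Qed.

Let modp_eq (P F : {poly R}) :
  P %% F = (lead_coef F ^+ scalp P F)%:P * P - P %/ F * F.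
Proof. by rewrite mul_polyC Pdiv.Idomain.divp_eq addrC addKr. Qed.

(* F and G are elements of Q and of Q + (B) of least degree with leading
   coefficient outside q.  Pseudo-division by them replaces Euclidean division over
   the fraction field of R/q: it shows that G is a constant, which serves as a
   Bezout certificate for F and B. *)
Lemma prime_ideal_extension (k : closedFieldType) (B : {poly R}) : ~ Q B ->
  exists2 a, ~ q a & forall phi : {rmorphism R -> k},
    (forall u, q u -> phi u = 0) -> phi a != 0 ->
    exists2 c, forall P, Q P -> (map_poly phi P).[c] = 0
             & (map_poly phi B).[c] != 0.
Proof.
move=> nQB.
(* If [Q] is just q R[X], then every c is a zero of the image of [Q] under phi, and it only remains
   to keep the image of [B] a nonzero polynomial: any coefficient of [B] outside [q] does that. *)
have [QqX|/existsNP[P0 /not_implyP[QP0 nP0]]] :=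
    pselect (forall P, Q P -> coefs_in_q P).
  have [j nBj] : exists j, ~ q B`_j.
    by apply/existsNP => qB; apply: nQB; apply: coefs_in_qW.
  exists B`_j => // phi phiq phiBj.
  have /closed_nonrootP[c nc] : map_poly phi B != 0.
    by apply: contra phiBj => /eqP B0; rewrite -coef_map B0 coef0.
  exists c => // P QP.
  suff -> : map_poly phi P = 0 by rewrite horner0.
  by apply/polyP => i; rewrite coef_map coef0; apply: phiq; apply: QqX.
have [F [QF nF minF]] : exists F, [/\ Q F, ~ q (lead_coef F) &
    forall P, Q P -> (size P < size F)%N -> coefs_in_q P].
  by apply: min_lead_coef => //; [move=> u v; apply: prime_idealB | exists P0].
have F_neq0 : F != 0.
  by apply/eqP => F0; apply: nF; rewrite F0 lead_coef0; apply: prime_ideal0.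
have qlcX s : ~ q (lead_coef F ^+ s) by move/(prime_idealX qprime).
have QmodF P : Q P -> coefs_in_q (P %% F).
  move=> QP; apply: minF; last by rewrite ltn_modp.
  by rewrite modp_eq; apply: prime_idealB => //; apply: prime_idealMl.
pose I P := exists u v, Q u /\ P = u + v * B.
have [G [IG nG minG]] : exists G, [/\ I G, ~ q (lead_coef G) &
    forall P, I P -> (size P < size G)%N -> coefs_in_q P].
  apply: min_lead_coef.
  - move=> _ _ [u [v [Qu ->]]] [u' [v' [Qu' ->]]].
    exists (u - u'), (v - v'); split; first exact: prime_idealB.
    by rewrite mulrBl opprD addrACA.
  - by move=> u Qu; exists u, 0; rewrite mul0r addr0.
  - by exists P0 => //; exists P0, 0; rewrite mul0r addr0.
have G_neq0 : G != 0.
  by apply/eqP => G0; apply: nG; rewrite G0 lead_coef0; apply: prime_ideal0.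
have IM a P : I P -> I (a * P).
  move=> [u [v [Qu ->]]]; exists (a * u), (a * v); split.
    exact: prime_idealMl.
  by rewrite mulrDr mulrA.
have ImodG P : I P -> coefs_in_q (P %% G).
  move=> IP; apply: minG; last by rewrite ltn_modp.
  have [u [v [Qu ->]]] := IP; have [u' [v' [Qu' ->]]] := IG.
  rewrite modp_eq; set c := (_ ^+ _)%:P; set H := _ %/ _.
  exists (c * u - H * u'), (c * v - H * v'); split.
    by apply: prime_idealB => //; apply: prime_idealMl.
  by rewrite !mulrDr mulrBl !mulrA opprD addrACA.
have [Gsize1|Gsize] := eqVneq (size G) 1%N.
  have [a /negP a_neq0 Ga] : exists2 a, ~ (a == 0) & G = a%:P.
    by have /eqP/size_poly1P[a ? ?] := Gsize1; exists a => //; apply/negP.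
  have nqa : ~ q a by rewrite -[a]lead_coefC -Ga.
  (* The factor [lead_coef F] preserves the degree of [F] under phi, which provides the root c, and
     lets [Q] vanish there by pseudo-division. The factor a, being of the form u + v B with u in
     [Q], forbids B to vanish at c. *)
  exists (a * lead_coef F); first by move/(prime_idealP qprime) => [].
  move=> phi phiq; rewrite rmorphM mulf_eq0 negb_or => /andP[phia phiF].
  have sF : (1 < size F)%N.
    rewrite ltnNge; apply/negP => /size1_polyC F1.
    by apply: nF; rewrite F1 lead_coefC /q -F1.
  have sphiF : size (map_poly phi F) = size F by rewrite size_poly_eq.
  have /closed_rootP[c /rootP rc] : size (map_poly phi F) != 1%N.
    by rewrite sphiF gtn_eqF.
  have Qc P : Q P -> (map_poly phi P).[c] = 0.
    move=> QP.
    have /(congr1 (fun P => (map_poly phi P).[c])) := Pdiv.Idomain.divp_eq P F.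
    rewrite -mul_polyC !rmorphD !rmorphM /= map_polyC !hornerE rc mulr0 add0r.
    have -> : map_poly phi (P %% F) = 0.
      by apply/polyP => i; rewrite coef_map coef0; apply: phiq; apply: QmodF.
    rewrite horner0 => /eqP; rewrite mulf_eq0 /= rmorphXn expf_eq0.
    by rewrite (negPf phiF) andbF => /eqP.
  exists c => //; apply: contraNneq phia => Bc.
  have [u [v [Qu Guv]]] := IG.
  have : (map_poly phi G).[c] = 0.
    by rewrite Guv rmorphD rmorphM !hornerE Qc // Bc mulr0 addr0.
  by rewrite Ga map_polyC hornerC => ->.
(* If [G] is not constant, pseudo-dividing [F] by [G] puts H G in [Q], where H is the quotient. If H
   is in [Q], its size forces it into q R[X], and with it the leading coefficient of [F] into [q].
   If [G] is in [Q], then so is a power of its leading coefficient times [B]. Both are excluded. *)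
exfalso.
have /(prime_idealP Qprime)[QH|QG] : Q (F %/ G * G).
- have -> : F %/ G * G = (lead_coef G ^+ scalp F G)%:P * F - F %% G.
    by rewrite modp_eq opprB addrC subrK.
  apply: prime_idealB => //; first exact: prime_idealMl.
  apply/coefs_in_qW/ImodG; exists F, 0; by rewrite mul0r addr0.
- have sGF : (size G <= size F)%N.
    rewrite leqNgt; apply/negP => /minG qF; apply: nF; apply: qF.
    by exists F, 0; rewrite mul0r addr0.
  have qH : coefs_in_q (F %/ G).
    apply: minF => //; rewrite Pdiv.Idomain.size_divp //.
    have : (1 < size G)%N.
      by rewrite ltn_neqAle eq_sym Gsize size_poly_gt0.
    move: sGF; case: (size G) (size F) => [|[|s]] [|t] //= _ _.
    by rewrite subSS ltnS leq_subr.
  have qF' : coefs_in_q ((lead_coef G ^+ scalp F G)%:P * F).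
    have -> : (lead_coef G ^+ scalp F G)%:P * F = F %/ G * G + F %% G.
      by rewrite mul_polyC Pdiv.Idomain.divp_eq.
    move=> i; rewrite coefD; apply: prime_idealD => //; last first.
      by apply: ImodG; exists F, 0; rewrite mul0r addr0.
    by rewrite coefM; apply: prime_ideal_sum => // j _; apply: prime_idealMr.
  have := qF' (size F).-1; rewrite coefCM => /(prime_idealP qprime)[|//].
  by move/(prime_idealX qprime).
- have qB : Q ((lead_coef G ^+ scalp B G)%:P * B).
    rewrite mul_polyC Pdiv.Idomain.divp_eq; apply: prime_idealD => //.
      exact: prime_idealMl.
    apply/coefs_in_qW/ImodG; exists 0, 1; rewrite mul1r add0r; split=> //.
    exact: prime_ideal0.
  by have [/(prime_idealX qprime)|] := prime_idealP Qprime qB.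
Qed.

End Extension.

Lemma mpoly_rmorph_eq (R : comNzRingType) n (S : comNzRingType)
    (f g : {rmorphism {mpoly R[n]} -> S}) :
  (forall c, f c%:MP = g c%:MP) -> (forall i, f 'X_i = g 'X_i) -> f =1 g.
Proof.
move=> fgC fgX P; rewrite [P]mpolyE !rmorph_sum; apply: eq_bigr => m _.
rewrite -mul_mpolyC !rmorphM fgC mpolyXE_id !rmorph_prod; congr (_ * _).
by apply: eq_bigr => i _; rewrite !rmorphXn fgX.
Qed.

(** The element b has to be arbitrary: the induction hypothesis is applied to the certificate [a] of
    [prime_ideal_extension], and the zero found where [a] does not vanish then extends by one
    coordinate. *)
Theorem nullstellensatz (k : closedFieldType) n (Q : {mpoly k[n]} -> Prop) b :
    prime_ideal Q -> ~ Q b ->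
  exists2 c : 'I_n -> k, forall P, Q P -> P.@[c] = 0 & b.@[c] != 0.
Proof.
elim: n => [|n IH] in Q b * => Qprime nQb.
  have constP (P : {mpoly k[0]}) : P = (P.@[fun=> 0])%:MP.
    apply: (@mpoly_rmorph_eq _ _ _ idfun
      ((@mpolyC 0 k : {rmorphism _ -> _}) \o meval (fun=> 0))).
      by move=> c /=; rewrite mevalC.
    by case.
  have Q_0 P : Q P -> P.@[fun=> 0] = 0.
    move=> QP; apply/eqP/negP => /negP nz; case: (Qprime) => _ + _ _; apply.
    have -> : 1 = ((P.@[fun=> 0])^-1)%:MP * P.
      by rewrite {2}[P]constP -mpolyCM mulVf.
    exact: prime_idealMl.
  exists (fun=> 0) => //; apply/eqP => b0; apply: nQb.
  by rewrite [b]constP b0 mpolyC0; apply: prime_ideal0.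
(* The last variable becomes the variable of a univariate polynomial ring over the others; [uni] and
   [multi] are the two directions of this identification. *)
pose X (i : 'I_n.+1) : {poly {mpoly k[n]}} :=
  if unlift ord_max i is Some j then ('X_j)%:P else 'X.
pose uni := mmap ((polyC : {rmorphism _ -> _}) \o @mpolyC n k) X.
pose widen := mmap (@mpolyC n.+1 k) (fun j : 'I_n => 'X_(lift ord_max j)).
pose multi : {rmorphism {poly {mpoly k[n]}} -> {mpoly k[n.+1]}} :=
  horner_morph (fun P => mulrC 'X_ord_max (widen P)).
have uniX i : uni 'X_i = X i by rewrite /uni mmapX mmap1U.
have uniC c : uni c%:MP = (c%:MP)%:P by rewrite /uni mmapC.
have multiC P : multi P%:P = widen P by exact: horner_morphC.
have multiX : multi 'X = 'X_ord_max by exact: horner_morphX.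
have uniK P : multi (uni P) = P.
  apply: (@mpoly_rmorph_eq _ _ _ (multi \o uni) idfun) => [c|i];
    rewrite -[LHS]/(multi (uni _)).
    by rewrite uniC multiC /widen mmapC.
  rewrite uniX /X; case: unliftP => [j|] -> /=; last by rewrite multiX.
  by rewrite multiC /widen mmapX mmap1U.
have Q'prime := prime_ideal_preim Qprime multi.
have [|a nQa extend] := @prime_ideal_extension _ _ Q'prime k (uni b).
  by rewrite uniK.
have [c' Qc' ac'] :=
  IH _ a (prime_ideal_preim Q'prime (polyC : {rmorphism _ -> _})) nQa.
have [c Qc bc] := extend (meval c') Qc' ac'.
pose e i := if unlift ord_max i is Some j then c' j else c.
have evalE P : P.@[e] = (map_poly (meval c') (uni P)).[c].
  apply: (@mpoly_rmorph_eq _ _ _ (meval e)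
    (horner_eval c \o map_poly (meval c') \o uni)) => [d|i];
    rewrite -[RHS]/((map_poly (meval c') (uni _)).[c]) -[LHS]/(_.@[e]).
    by rewrite uniC map_polyC hornerC /= !mevalC.
  rewrite uniX mevalXU /e /X.
  case: unliftP => [j|] _ /=; first by rewrite map_polyC hornerC /= mevalXU.
  by rewrite map_polyX hornerX.
by exists e => [P QP|]; rewrite evalE //; apply: Qc; rewrite uniK.
Qed.

(** * The superexterior algebra as a ring *)

Section SuperExteriorRing.
Variables (k : fieldType) (m n : nat).
Local Notation superext := (superext k m n).
Implicit Types (a b c : superext) (S T U V W : {set 'I_m}) (P Q : {mpoly k[n]}).

Local Notation below i S := #|[set s in S | (s < i)%N]|.

Lemma inversionsE S T :
  inversions S T = (\sum_(s in S) \sum_(t in T) (t < s)%N)%N.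
Proof.
rewrite /inversions -sum1_card pair_big /= big_mkcond [RHS]big_mkcond /=.
apply: eq_bigr => -[s t] _; rewrite inE /=.
by case: (s \in S) (t \in T) (t < s)%N => [] [] [].
Qed.

Lemma belowE i S : below i S = (\sum_(s in S) (s < i)%N)%N.
Proof.
rewrite -sum1_card big_mkcond [RHS]big_mkcond /=.
by apply: eq_bigr => s _; rewrite inE; case: (s \in S) (s < i)%N => [] [].
Qed.

Lemma belowU1 i j S : j \notin S -> below i (j |: S)%SET = ((j < i) + below i S)%N.
Proof. by move=> jS; rewrite !belowE big_setU1. Qed.

Lemma belowD1 i j S : j \in S -> below i S = ((j < i) + below i (S :\ j)%SET)%N.
Proof. by move=> jS; rewrite !belowE (big_setD1 j). Qed.

Lemma below_setD1 i S : below i (S :\ i)%SET = below i S.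
Proof.
by apply: eq_card => s; rewrite !inE; case: eqVneq => // ->; rewrite ltnn !andbF.
Qed.

Lemma inversions1 i S : inversions [set i]%SET S = below i S.
Proof. by rewrite inversionsE big_set1 belowE. Qed.

Lemma inversions0l S : inversions finset.set0 S = 0%N.
Proof. by rewrite inversionsE big_set0. Qed.

Lemma inversions0r S : inversions S finset.set0 = 0%N.
Proof. by rewrite inversionsE big1 // => s _; rewrite big_set0. Qed.

Lemma sum_setU_disjoint (F : 'I_m -> nat) S T : [disjoint S & T] ->
  (\sum_(s in (S :|: T)%SET) F s = \sum_(s in S) F s + \sum_(s in T) F s)%N.
Proof.
by move=> ST; rewrite -bigU //; apply: eq_bigl => s; rewrite !inE.
Qed.

Lemma inversionsUl S T U : [disjoint S & T] ->
  inversions (S :|: T)%SET U = (inversions S U + inversions T U)%N.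
Proof. by move=> ST; rewrite !inversionsE sum_setU_disjoint. Qed.

Lemma inversionsUr S T U : [disjoint T & U] ->
  inversions S (T :|: U)%SET = (inversions S T + inversions S U)%N.
Proof.
move=> TU; rewrite !inversionsE -big_split; apply: eq_bigr => s _ /=.
by rewrite sum_setU_disjoint.
Qed.

HB.instance Definition _ t := GRing.isZmodMorphism.Build {mpoly k[n]} {mpoly k[n]}
  (@ytwist k n t) (comp_mpoly_is_additive _).
HB.instance Definition _ t := GRing.isScalable.Build k {mpoly k[n]} {mpoly k[n]} *:%R
  (@ytwist k n t) (comp_mpoly_is_linear _).
HB.instance Definition _ t := GRing.isMonoidMorphism.Build {mpoly k[n]} {mpoly k[n]}
  (@ytwist k n t) (conj (comp_mpoly1 _) (rmorphM (comp_mpoly _))).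

Lemma ytwistX t j : ytwist t ('X_j : {mpoly k[n]}) = (-1) ^+ t *: 'X_j.
Proof. by rewrite /ytwist comp_mpolyXU -tnth_nth tnth_mktuple. Qed.

Lemma ytwistC t (x : k) : ytwist t (x%:MP : {mpoly k[n]}) = x%:MP.
Proof. exact: comp_mpolyC. Qed.

Lemma ytwistZ t (x : k) P : ytwist t (x *: P) = x *: ytwist t P.
Proof. exact: comp_mpolyZ. Qed.

Lemma ytwistM t P Q : ytwist t (P * Q) = ytwist t P * ytwist t Q.
Proof. exact: rmorphM. Qed.

Lemma ytwistD t u P : ytwist t (ytwist u P) = ytwist (t + u) P.
Proof.
apply: (@mpoly_rmorph_eq _ _ _ (ytwist t \o ytwist u) (ytwist (t + u))) => [x|i] /=.
  by rewrite !ytwistC.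
by rewrite !ytwistX linearZ /= ytwistX scalerA -exprD addnC.
Qed.

Lemma ytwist0 P : ytwist 0 P = P.
Proof.
apply: (@mpoly_rmorph_eq _ _ _ (ytwist 0) idfun) => [x|i] /=.
  by rewrite ytwistC.
by rewrite ytwistX scale1r.
Qed.

Lemma smulE a b U : smul a b U = \sum_(S in powerset U)
  (-1) ^+ inversions S (U :\: S) *: (ytwist #|U :\: S| (a S) * b (U :\: S)%SET).
Proof. by rewrite ffunE. Qed.

(** Both sides are sums over the ordered partitions of U into S, V, W. The signs agree because
    [inversions] is additive in each argument over disjoint unions, and the twists because [ytwist]
    is additive in its exponent. *)
Lemma smulA : associative (@smul k m n).
Proof.
move=> a b c; apply/ffunP => U; rewrite [LHS]smulE [RHS]smulE.
under [RHS]eq_bigr => T _ do rewrite smulE linear_sum mulr_suml scaler_sumr.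
rewrite [RHS](exchange_big_dep (mem (powerset U))) /=; last first.
  by move=> T S; rewrite !powersetE => TU ST; apply: fintype.subset_trans TU.
apply: eq_bigr => S; rewrite powersetE => SU.
rewrite smulE mulr_sumr scaler_sumr.
(* On the right the outer set is T, the union of S and V. *)
rewrite [RHS](reindex_onto (fun V => (S :|: V)%SET) (fun T => (T :\: S)%SET)) /=;
  last first.
  move=> T /andP[_]; rewrite powersetE => ST.
  apply/setP => i; rewrite !inE; move/fintype.subsetP: ST => /(_ i).
  by case: (i \in S) (i \in T) => [] [] // ->.
apply: eq_big => [V|V].
  rewrite !powersetE finset.subsetUl andbT finset.subUset SU finset.subsetD.
  congr (_ && _).
  by rewrite finset.setDUl finset.setDv finset.set0U; apply: sameP finset.setDidPl eqP.
rewrite powersetE finset.subsetD => /andP[VU dVS].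
have dSV : [disjoint S & V] by rewrite disjoint_sym.
have -> : ((S :|: V) :\: S = V)%SET.
  by rewrite finset.setDUl finset.setDv finset.set0U; apply/finset.setDidPl.
set W := (U :\: (S :|: V))%SET.
have UDS : (U :\: S = V :|: W)%SET.
  apply/setP => i; rewrite !inE.
  have := fintype.subsetP VU i; have := disjointFr dVS (x := i).
  by case: (i \in V) (i \in S) (i \in U) => [] [] [] //= H1 H2; move: (H1 isT) (H2 isT).
have dVW : [disjoint V & W].
  rewrite /W finset.setDUr disjoint_sym finset.disjoints_subset.
  by apply/fintype.subsetP => i; rewrite !inE => /and3P[].
have -> : ((U :\: S) :\: V = W)%SET by rewrite finset.setDDl.
rewrite UDS inversionsUr // inversionsUl // cardsU.
have -> : (V :&: W = finset.set0)%SET by apply/eqP; rewrite finset.setI_eq0.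
rewrite finset.cards0 subn0 linearZ /= ytwistM ytwistD.
rewrite (addnC #|V|).
move: (ytwist _ (a S)) (ytwist _ (b V)) (c W) => Pa Pb Pc.
rewrite -scalerAl scalerA -exprD -scalerAr scalerA -exprD mulrA.
by rewrite -addnA addnC.
Qed.


Lemma sym_incl_mulE P b U : smul (sym_incl m P) b U = ytwist #|U| P * b U.
Proof.
rewrite smulE (bigD1 finset.set0) ?powersetE ?finset.sub0set //= big1 => [|S /andP[_ S0]].
  by rewrite addr0 finset.setD0 ffunE eqxx inversions0l scale1r.
by rewrite ffunE (negPf S0) rmorph0 mul0r scaler0.
Qed.

Lemma xgen_mulE i b U : smul (xgen k n i) b U =
  if i \in U then (-1) ^+ below i U *: b (U :\ i)%SET else 0.
Proof.
have xS S : xgen k n i S = (S == [set i]%SET)%:R by rewrite ffunE.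
rewrite smulE; case: ifP => iU.
  rewrite (bigD1 [set i]%SET) ?powersetE ?finset.sub1set //= big1 => [|S /andP[_ Si]].
    by rewrite xS eqxx rmorph1 mul1r addr0 inversions1 below_setD1.
  by rewrite xS (negPf Si) rmorph0 mul0r scaler0.
rewrite big1 // => S; rewrite powersetE xS => SU.
case: eqVneq => [Si|_]; last by rewrite rmorph0 mul0r scaler0.
by move: SU; rewrite Si finset.sub1set iU.
Qed.

Lemma superextD a b U : (a + b) U = a U + b U. Proof. exact: ffunE. Qed.

Lemma superextZ (x : k) a U : (x *: a) U = x *: a U. Proof. exact: ffunE. Qed.

Lemma superextN a U : (- a) U = - a U. Proof. exact: ffunE. Qed.

Lemma superext0 U : (0 : superext) U = 0. Proof. exact: ffunE. Qed.

Lemma superext_sum (I : Type) (r : seq I) (p : pred I) (F : I -> superext) U :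
  (\sum_(i <- r | p i) F i) U = \sum_(i <- r | p i) F i U.
Proof.
rewrite (big_morph (fun a => a U) (id1 := 0) (op1 := +%R)) ?superext0 // => a b.
exact: superextD.
Qed.

Lemma smulDl : left_distributive (@smul k m n) +%R.
Proof.
move=> a b c; apply/ffunP => U; rewrite [LHS]smulE [RHS]superextD.
rewrite (smulE a c) (smulE b c) -big_split; apply: eq_bigr => S _ /=.
by rewrite superextD rmorphD mulrDl scalerDr.
Qed.

Lemma smulDr : right_distributive (@smul k m n) +%R.
Proof.
move=> a b c; apply/ffunP => U; rewrite [LHS]smulE [RHS]superextD.
rewrite (smulE a b) (smulE a c) -big_split; apply: eq_bigr => S _ /=.
by rewrite superextD mulrDr scalerDr.
Qed.

Lemma smul1l : left_id (sym_incl m 1) (@smul k m n).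
Proof. by move=> a; apply/ffunP => U; rewrite sym_incl_mulE rmorph1 mul1r. Qed.

Lemma smul1r : right_id (sym_incl m 1) (@smul k m n).
Proof.
move=> a; apply/ffunP => U; rewrite smulE (bigD1 U) ?powersetE //= big1 => [|S /andP[]].
  rewrite finset.setDv ffunE eqxx inversions0r finset.cards0 ytwist0 mulr1 scale1r.
  by rewrite addr0.
rewrite powersetE finset.eqEsubset => -> /=; rewrite ffunE -finset.setD_eq0 => /negPf ->.
by rewrite mulr0 scaler0.
Qed.

Lemma sym_incl1_neq0 : sym_incl m 1 != 0 :> superext.
Proof.
apply/eqP => /ffunP/(_ finset.set0); rewrite !ffunE eqxx; apply/eqP; exact: oner_neq0.
Qed.

Lemma smulZl (x : k) a b : x *: smul a b = smul (x *: a) b.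
Proof.
apply/ffunP => U; rewrite superextZ [RHS]smulE smulE scaler_sumr; apply: eq_bigr => S _.
by rewrite superextZ ytwistZ -scalerAl !scalerA mulrC.
Qed.

Lemma smulZr (x : k) a b : x *: smul a b = smul a (x *: b).
Proof.
apply/ffunP => U; rewrite superextZ [RHS]smulE smulE scaler_sumr; apply: eq_bigr => S _.
by rewrite superextZ -scalerAr !scalerA mulrC.
Qed.

Fact smul_key : unit. Proof. exact: tt. Qed.

(* Locked, since unification would otherwise unfold products to finite functions. *)
Definition superext_mul : superext -> superext -> superext :=
  locked_with smul_key (@smul k m n).

Lemma superext_mulE : superext_mul = @smul k m n.
Proof. exact: locked_withE. Qed.

Lemma superext_mulA : associative superext_mul.
Proof. by rewrite superext_mulE; apply: smulA. Qed.

Lemma superext_mul1l : left_id (sym_incl m 1) superext_mul.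
Proof. by rewrite superext_mulE; apply: smul1l. Qed.

Lemma superext_mul1r : right_id (sym_incl m 1) superext_mul.
Proof. by rewrite superext_mulE; apply: smul1r. Qed.

Lemma superext_mulDl : left_distributive superext_mul +%R.
Proof. by rewrite superext_mulE; apply: smulDl. Qed.

Lemma superext_mulDr : right_distributive superext_mul +%R.
Proof. by rewrite superext_mulE; apply: smulDr. Qed.

HB.instance Definition _ := GRing.Zmodule_isNzRing.Build superext
  superext_mulA superext_mul1l superext_mul1r superext_mulDl superext_mulDr
  sym_incl1_neq0.

Lemma mul_smul a b : a * b = smul a b.
Proof. by rewrite -superext_mulE. Qed.

Lemma superext_scalerAl (c : k) a b : c *: (a * b) = (c *: a) * b.
Proof. by rewrite !mul_smul smulZl. Qed.

Lemma superext_scalerAr (c : k) a b : c *: (a * b) = a * (c *: b).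
Proof. by rewrite !mul_smul smulZr. Qed.

HB.instance Definition _ :=
  GRing.Lmodule_isLalgebra.Build k superext superext_scalerAl.
HB.instance Definition _ :=
  GRing.Lalgebra_isAlgebra.Build k superext superext_scalerAr.

Implicit Types (i : 'I_m) (j : 'I_n).
Local Notation x := (xgen k n).
Local Notation y := (ygen k m).

Lemma xgenE i b U : (x i * b) U =
  if i \in U then (-1) ^+ below i U *: b (U :\ i)%SET else 0.
Proof. by rewrite mul_smul xgen_mulE. Qed.

Lemma sym_inclE P b U : (sym_incl m P * b) U = ytwist #|U| P * b U.
Proof. by rewrite mul_smul sym_incl_mulE. Qed.

Lemma ygenE j b U : (y j * b) U = (-1) ^+ #|U| *: ('X_j * b U).
Proof. by rewrite sym_inclE ytwistX scalerAl. Qed.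

(** The component at the empty set is the image modulo the ideal generated by the x_i, hence
    multiplicative. *)
Lemma superext_mul0 a b :
  (a * b) finset.set0 = a finset.set0 * b finset.set0.
Proof.
rewrite mul_smul smulE powerset0 big_set1 finset.setD0.
by rewrite inversions0l finset.cards0 ytwist0 scale1r.
Qed.

Lemma sym_inclM P Q : sym_incl m (P * Q) = sym_incl m P * sym_incl m Q.
Proof.
apply/ffunP => U; rewrite sym_inclE !ffunE; case: eqP => [->|_].
  by rewrite finset.cards0 ytwist0.
by rewrite mulr0.
Qed.

Lemma sym_inclD P Q : sym_incl m (P + Q) = sym_incl m P + sym_incl m Q.
Proof. by apply/ffunP => U; rewrite superextD !ffunE; case: ifP; rewrite ?addr0. Qed.

Lemma sym_inclZ (c : k) P : sym_incl m (c *: P) = c *: sym_incl m P.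
Proof. by apply/ffunP => U; rewrite superextZ !ffunE; case: ifP; rewrite ?scaler0. Qed.

Lemma sym_inclX P e : sym_incl m (P ^+ e) = sym_incl m P ^+ e.
Proof. by elim: e => [//|e IH]; rewrite !exprS sym_inclM IH. Qed.

Lemma sym_incl0 : sym_incl m (0 : {mpoly k[n]}) = 0.
Proof. by rewrite -(scale0r (0 : {mpoly k[n]})) sym_inclZ scale0r. Qed.

Lemma sym_incl_sum (I : Type) (r : seq I) (p : pred I) (F : I -> {mpoly k[n]}) :
  sym_incl m (\sum_(i <- r | p i) F i) = \sum_(i <- r | p i) sym_incl m (F i).
Proof. exact: (big_morph _ sym_inclD sym_incl0). Qed.

Lemma ygenM (i j : 'I_n) : y i * y j = sym_incl m ('X_i * 'X_j).
Proof. by rewrite sym_inclM. Qed.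

Lemma ygenC (i j : 'I_n) : y i * y j = y j * y i.
Proof. by rewrite !ygenM mulrC. Qed.

Lemma xgen_sqr i : x i * x i = 0.
Proof.
apply/ffunP => U; rewrite xgenE superext0; case: ifP => // _.
by rewrite ffunE finset.eqEsubset finset.sub1set finset.setD11 andbF scaler0.
Qed.

Lemma xgen_anticomm_mul (i j : 'I_m) b : x i * (x j * b) = - (x j * (x i * b)).
Proof.
have [<-|ij] := eqVneq i j; first by rewrite mulrA xgen_sqr mul0r oppr0.
apply/ffunP => U; rewrite superextN (xgenE i (x j * b)) (xgenE j (x i * b)).
rewrite (xgenE j b) (xgenE i b) !in_setD1 ij eq_sym ij /=.
case: ifP => iU; case: ifP => jU; rewrite ?scaler0 ?oppr0 //.
rewrite [(U :\ j :\ i)%SET]finset.setDDl finset.setUC -finset.setDDl !scalerA -!exprD.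
rewrite -scaleNr; congr (_ *: _).
rewrite (belowD1 i jU) (belowD1 j iU).
(* Exactly one of i < j and j < i holds, so the two exponents differ by one. *)
by move: ij; rewrite -val_eqE /=; case: ltngtP => //= _ _;
  rewrite !add0n !add1n ?addSn ?addnS exprS mulN1r ?opprK addnC.
Qed.

Lemma xgen_anticomm (i j : 'I_m) : x i * x j = - (x j * x i).
Proof. by have := xgen_anticomm_mul i j 1; rewrite !mulr1. Qed.

Lemma ygen_xgen i j : y j * x i = - (x i * y j).
Proof.
suff xy1 : y j * (x i * 1) = - (x i * (y j * 1)) by rewrite !mulr1 in xy1.
apply/ffunP => U; rewrite superextN ygenE (xgenE i (y j * 1)) (xgenE i 1).
case: ifP => iU; last by rewrite mulr0 scaler0 oppr0.
rewrite ygenE (cardsD1 i U) iU add1n -scalerAr !scalerA.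
by rewrite -exprD addSn -scaleNr exprS mulN1r addnC exprD.
Qed.

(** * Superderivatives and left multiplication by generators *)

Lemma dx_is_linear i : linear (@dx k m n i).
Proof.
move=> c a b; apply/ffunP => S; rewrite superextD superextZ !ffunE.
by case: ifP; rewrite ?scaler0 ?addr0 // scalerDr !scalerA mulrC.
Qed.

Lemma dy_is_linear j : linear (@dy k m n j).
Proof.
move=> c a b; apply/ffunP => S; rewrite superextD superextZ !ffunE.
by rewrite mderivD mderivZ scalerDr !scalerA mulrC.
Qed.

HB.instance Definition _ i := GRing.isLinear.Build k superext superext *:%R
  (dx i) (dx_is_linear i).
HB.instance Definition _ j := GRing.isLinear.Build k superext superext *:%R
  (dy j) (dy_is_linear j).

Lemma dxE i a S : dx i a S =
  if i \in S then 0 else (-1) ^+ below i S *: a (i |: S)%SET.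
Proof. exact: ffunE. Qed.

Lemma dyE j a S : dy j a S = (-1) ^+ #|S| *: (a S)^`M(j).
Proof. exact: ffunE. Qed.

Lemma signr_sqr e : (-1) ^+ e * (-1) ^+ e = 1 :> k.
Proof. by rewrite -exprD addnn -mul2n exprM sqrrN expr1n expr1n. Qed.

(** In this and the next three relations, a derivative of Z-degree -1 passing a generator of
    Z-degree 1 costs a sign; for [dy] and a y the two odd parities cost a second one, which cancels
    the first. *)
Lemma dx_xgenM (i j : 'I_m) b : dx i (x j * b) = (i == j)%:R *: b - x j * dx i b.
Proof.
apply/ffunP => S; rewrite superextD superextN superextZ dxE.
rewrite (xgenE j b) (xgenE j (dx i b)) dxE.
have [<-|ij] := eqVneq i j.
  rewrite finset.setU11 finset.setD11 /= scale1r.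
  case: ifP => iS; rewrite ?subr0.
    by rewrite finset.setD1K // below_setD1 scalerA signr_sqr scale1r subrr.
  by rewrite finset.setU1K ?iS // belowU1 ?iS // ltnn scalerA signr_sqr scale1r.
rewrite scale0r add0r !inE (negPf ij) eq_sym (negPf ij) /=.
case: ifP => iS; first by rewrite scaler0 if_same oppr0.
case: ifP => jS; rewrite ?scaler0 ?oppr0 //.
have -> : ((i |: S) :\ j = i |: (S :\ j))%SET.
  by apply/setP => s; rewrite !inE; case: (eqVneq s i) => [->|]; rewrite ?ij ?orbF //= .
rewrite belowU1 ?iS // (belowD1 i jS) !scalerA -!exprD -scaleNr; congr (_ *: _).
by move: ij; rewrite -val_eqE /=; case: ltngtP => //= _ _;
  rewrite !add0n !add1n ?addSn ?addnS exprS mulN1r ?opprK addnC.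
Qed.

Lemma dx_ygenM i j b : dx i (y j * b) = - (y j * dx i b).
Proof.
apply/ffunP => S; rewrite superextN dxE (ygenE j b) (ygenE j (dx i b)) dxE.
case: ifP => iS; first by rewrite mulr0 scaler0 oppr0.
rewrite cardsU1 iS -scalerAr !scalerA -scaleNr; congr (_ *: _).
by rewrite add1n exprS mulN1r mulrN mulrC.
Qed.

Lemma dy_xgenM i j b : dy j (x i * b) = - (x i * dy j b).
Proof.
apply/ffunP => S; rewrite superextN dyE (xgenE i b) (xgenE i (dy j b)) dyE.
case: ifP => iS; last by rewrite mderiv0 scaler0 oppr0.
rewrite mderivZ !scalerA -scaleNr; congr (_ *: _).
by rewrite (cardsD1 i S) iS add1n exprS mulN1r mulNr mulrC.
Qed.

Lemma dy_ygenM (i j : 'I_n) b : dy i (y j * b) = (i == j)%:R *: b + y j * dy i b.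
Proof.
apply/ffunP => S; rewrite superextD superextZ dyE (ygenE j b) (ygenE j (dy i b)) dyE.
rewrite mderivZ !scalerA signr_sqr scale1r mderivM mderivX mnm1E.
rewrite -scalerAr scalerA signr_sqr scale1r eq_sym; congr (_ + _).
case: eqVneq => [->|_]; last by rewrite !scale0r mul0r.
have subUU l : (U_(l) - U_(l) = 0 :> 'X_{1..n})%MM.
  by apply/mnmP => l'; rewrite !mnmE subnn.
by rewrite !scale1r subUU mpolyX0 mul1r.
Qed.

End SuperExteriorRing.

(** * Powers of sums in characteristic p, symmetric and cyclic sums *)

Lemma sum_expr_pchar_eq0 (R : nzRingType) p (I : Type) (r : seq I) (P : pred I)
    (F : I -> R) : p \in [pchar R] ->
    (forall i j, GRing.comm (F i) (F j)) -> (forall i, F i ^+ p = 0) ->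
  (\sum_(i <- r | P i) F i) ^+ p = 0.
Proof.
move=> charRp Fcomm Fp; elim: r => [|i r IH].
  by rewrite big_nil expr0n gtn_eqF // (prime_gt0 (pcharf_prime charRp)).
rewrite big_cons; case: ifP => // _; rewrite -(pFrobenius_autE charRp).
rewrite pFrobenius_autD_comm ?pFrobenius_autE ?Fp ?IH ?addr0 //.
by apply: commr_sum.
Qed.

Section Sums.
Variable V : zmodType.

Lemma sum_sym n (F : 'I_n -> 'I_n -> V) : (forall i j, F i j = F j i) ->
  \sum_i \sum_j F i j = (\sum_(i < n) \sum_(j < n | (i < j)%N) F i j) *+ 2 + \sum_i F i i.
Proof.
move=> Fsym; have split_row (i : 'I_n) : \sum_j F i j =
    \sum_(j < n | (i < j)%N) F i j + \sum_(j < n | (j < i)%N) F i j + F i i.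
  rewrite (bigD1 i) //= addrC; congr (_ + _).
  rewrite (bigID (fun j : 'I_n => (i < j)%N)) /=; congr (_ + _); apply: eq_bigl => j.
    by rewrite -val_eqE /=; case: ltngtP.
  by rewrite -val_eqE /=; case: ltngtP.
rewrite (eq_bigr _ (fun i _ => split_row i)) !big_split /= mulr2n; congr (_ + _ + _).
rewrite (exchange_big_dep xpredT) //=; apply: eq_bigr => i _.
by apply: eq_bigr => j _.
Qed.

Let sum_rot n (G : 'I_n -> 'I_n -> 'I_n -> V) :
  \sum_a \sum_b \sum_c G a b c = \sum_a \sum_b \sum_c G b c a.
Proof.
by rewrite [RHS]exchange_big; under [RHS]eq_bigr => a _ do rewrite exchange_big.
Qed.

(* In characteristic 3 it does not suffice to average over cyclic
   permutations: the sum is instead rearranged so that the first index is the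
   strictly smallest. *)
Lemma sum_cyclic0 n (F : 'I_n -> 'I_n -> 'I_n -> V) :
    (forall a b c, F a b c + F b c a + F c a b = 0) ->
    (forall a b c, [|| a == b, b == c | c == a] -> F a b c = 0) ->
  \sum_a \sum_b \sum_c F a b c = 0.
Proof.
move=> Fcyc Frep; pose first (a b c : 'I_n) := (a < b)%N && (a < c)%N.
(* For distinct indices exactly one of the three rotations has the smallest index in front; for
   repeated ones both sides vanish. *)
have FE a b c : F a b c =
    F a b c *+ first a b c + F a b c *+ first b c a + F a b c *+ first c a b.
  have [/Frep ->|] := boolP [|| a == b, b == c | c == a].
    by rewrite !mul0rn !addr0.
  rewrite /first -!val_eqE /=.
  case: (ltngtP a b) => // ab; case: (ltngtP b c) => // bc; case: (ltngtP c a) => // ca _;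
    rewrite ?mulr0n ?mulr1n ?addr0 ?add0r //.
  - by have := ltn_trans ab (ltn_trans bc ca); rewrite ltnn.
  - by have := ltn_trans ab (ltn_trans ca bc); rewrite ltnn.
under eq_bigr => a _ do under eq_bigr => b _ do under eq_bigr => c _ do rewrite FE.
under eq_bigr => a _ do under eq_bigr => b _ do rewrite !big_split.
under eq_bigr => a _ do rewrite !big_split.
rewrite !big_split /=.
(* Rotating the summation indices gives all three sums the same factor [first a b c], after which
   [Fcyc] applies term by term. *)
rewrite (sum_rot (fun a b c => F a b c *+ first c a b)).
rewrite [X in _ + X + _]sum_rot [X in _ + X + _]sum_rot.
rewrite -!big_split big1 // => a _; rewrite -!big_split big1 // => b _.
rewrite -!big_split big1 // => c _ /=; rewrite -!mulrnDl.
by rewrite addrAC Fcyc mul0rn.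
Qed.

End Sums.

(** * Lie superalgebras in coordinates *)

Section LieSuperalgebra.
Variables (k : fieldType) (g : lieSuperalgebra k).
Local Notation g0 := (component g false).
Local Notation g1 := (component g true).
Local Notation "[ u , v ]" := (sbracket u v).
Local Notation e := (tnth (ebasis g)).
Local Notation o := (tnth (obasis g)).
Implicit Types (u v z : g).

Lemma sbracketDr u v z : [u, v + z] = [u, v] + [u, z].
Proof. by have := sbracket_linearr u 1 v z; rewrite !scale1r. Qed.

Lemma sbracketDl u v z : [u + v, z] = [u, z] + [v, z].
Proof. by have := sbracket_linearl z 1 u v; rewrite !scale1r. Qed.

Lemma sbracket0r u : [u, 0] = 0.
Proof. by apply: (addrI [u, 0]); rewrite -sbracketDr !addr0. Qed.

Lemma sbracket0l u : [0, u] = 0.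
Proof. by apply: (addrI [0, u]); rewrite -sbracketDl !addr0. Qed.

Lemma sbracketZr u (c : k) v : [u, c *: v] = c *: [u, v].
Proof. by have := sbracket_linearr u c v 0; rewrite !addr0 sbracket0r addr0. Qed.

Lemma sbracketZl (c : k) u v : [c *: u, v] = c *: [u, v].
Proof. by have := sbracket_linearl v c u 0; rewrite !addr0 sbracket0l addr0. Qed.

Lemma sbracket_sumr u (I : Type) (r : seq I) (P : pred I) (c : I -> k) (w : I -> g) :
  [u, \sum_(i <- r | P i) c i *: w i] = \sum_(i <- r | P i) c i *: [u, w i].
Proof.
rewrite (big_morph (sbracket u) (sbracketDr u) (sbracket0r u)).
by apply: eq_bigr => i _; rewrite sbracketZr.
Qed.

Lemma sbracket_suml u (I : Type) (r : seq I) (P : pred I) (c : I -> k) (w : I -> g) :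
  [\sum_(i <- r | P i) c i *: w i, u] = \sum_(i <- r | P i) c i *: [w i, u].
Proof.
rewrite (big_morph (fun v => [v, u]) (fun v z => sbracketDl v z u) (sbracket0l u)).
by apply: eq_bigr => i _; rewrite sbracketZl.
Qed.

Lemma ebasis_mem i : e i \in g0. Proof. exact/vbasis_mem/mem_tnth. Qed.
Lemma obasis_mem j : o j \in g1. Proof. exact/vbasis_mem/mem_tnth. Qed.

Local Notation hbasis := (cat_tuple (ebasis g) (obasis g)).

Lemma hbasis_basis : basis_of fullv hbasis.
Proof.
rewrite -(component_add g); apply: (cat_basis _ (vbasisP _) (vbasisP _)).
by apply/directv_addP; rewrite component_cap.
Qed.

Lemma edual_linear i : linear_for *%R (@edual k g i).
Proof. by move=> c u v; rewrite /edual linearP. Qed.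

Lemma odual_linear j : linear_for *%R (@odual k g j).
Proof. by move=> c u v; rewrite /odual linearP. Qed.

HB.instance Definition _ i :=
  GRing.isLinear.Build k g k *%R (@edual k g i) (edual_linear i).
HB.instance Definition _ j :=
  GRing.isLinear.Build k g k *%R (@odual k g j) (odual_linear j).

Lemma hbasis_lshift i : hbasis`_(lshift (\dim g1) i) = e i.
Proof. by rewrite /= nth_cat size_tuple ltn_ord (tnth_nth 0). Qed.

Lemma hbasis_rshift j : hbasis`_(rshift (\dim g0) j) = o j.
Proof. by rewrite /= nth_cat size_tuple ltnNge leq_addr /= addKn (tnth_nth 0). Qed.

Lemma edual_o i l : edual i (o l) = 0.
Proof.
by rewrite /edual -hbasis_rshift coord_free ?(basis_free hbasis_basis) // eq_rlshift.
Qed.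

Lemma odual_e j l : odual j (e l) = 0.
Proof.
by rewrite /odual -hbasis_lshift coord_free ?(basis_free hbasis_basis) // eq_lrshift.
Qed.

Lemma odual_o j l : odual j (o l) = (l == j)%:R.
Proof.
by rewrite /odual -hbasis_rshift coord_free ?(basis_free hbasis_basis) ?eq_rshift.
Qed.

Lemma edual_odd i z : z \in g1 -> edual i z = 0.
Proof.
move/coord_vbasis ->; rewrite linear_sum big1 // => l _.
by rewrite linearZ /= -tnth_nth edual_o mulr0.
Qed.

Lemma odual_even j z : z \in g0 -> odual j z = 0.
Proof.
move/coord_vbasis ->; rewrite linear_sum big1 // => l _.
by rewrite linearZ /= -tnth_nth odual_e mulr0.
Qed.

Lemma dual_decomp z :
  z = \sum_i edual i z *: e i + \sum_j odual j z *: o j.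
Proof.
rewrite {1}(coord_basis hbasis_basis (memvf z)) big_split_ord /=.
by congr (_ + _); apply: eq_bigr => i _; rewrite -?hbasis_lshift -?hbasis_rshift.
Qed.

Lemma edual_decomp z : z \in g0 -> z = \sum_i edual i z *: e i.
Proof.
move=> z0; rewrite {1}[z]dual_decomp [X in _ + X]big1 ?addr0 // => j _.
by rewrite odual_even ?scale0r.
Qed.

Lemma odual_decomp z : z \in g1 -> z = \sum_j odual j z *: o j.
Proof.
move=> z1; rewrite {1}[z]dual_decomp [X in X + _]big1 ?add0r // => i _.
by rewrite edual_odd ?scale0r.
Qed.

Lemma bracket_ee i l : [e i, e l] \in g0.
Proof. exact: (sbracket_graded (ebasis_mem i) (ebasis_mem l)). Qed.

Lemma bracket_eo i l : [e i, o l] \in g1.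
Proof. exact: (sbracket_graded (ebasis_mem i) (obasis_mem l)). Qed.

Lemma bracket_oo i l : [o i, o l] \in g0.
Proof. exact: (sbracket_graded (obasis_mem i) (obasis_mem l)). Qed.

Lemma sbracket_skew_even u v (a : bool) :
  u \in g0 -> v \in component g a -> [u, v] = - [v, u].
Proof. by move=> u0 va; rewrite (sbracket_skew u0 va) scale1r. Qed.

Lemma sbracket_sym_odd u v : u \in g1 -> v \in g1 -> [u, v] = [v, u].
Proof. by move=> u1 v1; rewrite (sbracket_skew u1 v1) expr1 scaleN1r opprK. Qed.

Lemma jacobi_even u v z (a : bool) : u \in g0 -> v \in component g a ->
  [u, [v, z]] = [[u, v], z] + [v, [u, z]].
Proof. by move=> u0 va; rewrite (sbracket_jacobi z u0 va) scale1r. Qed.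

End LieSuperalgebra.

(** * The Koszul differential *)

Section Koszul.
Variables (k : fieldType) (g : lieSuperalgebra k).
Hypothesis two_neq0 : 2%:R != 0 :> k.
Local Notation g0 := (component g false).
Local Notation g1 := (component g true).
Local Notation "[ u , v ]" := (sbracket u v).
Local Notation e := (tnth (ebasis g)).
Local Notation o := (tnth (obasis g)).
Local Notation cochain := (superext k (\dim g0) (\dim g1)).
Local Notation x := (@xgen k (\dim g0) (\dim g1)).
Local Notation y := (@ygen k (\dim g0) (\dim g1)).
Local Notation w i := (cobracket (@edual k g i)).
Local Notation v j := (cobracket (@odual k g j)).
Local Notation D := (@koszul_diff k g).
Implicit Types (z u : g).

Let scale2_inj : injective ( *:%R 2%:R : cochain -> cochain).
Proof. exact: scalerI. Qed.

Lemma cobracketE (f : g -> k) : cobracket f =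
    \sum_(i < \dim g0) \sum_(j < \dim g0 | (i < j)%N) f [e i, e j] *: (x i * x j)
  + \sum_(i < \dim g0) \sum_(j < \dim g1) f [e i, o j] *: (x i * y j)
  + \sum_(i < \dim g1) \sum_(j < \dim g1 | (i < j)%N) f [o i, o j] *: (y i * y j)
  + \sum_(j < \dim g1) (f [o j, o j] / 2%:R) *: (y j * y j).
Proof. by rewrite /cobracket -superext_mulE. Qed.

Lemma koszul_diffE (a : cochain) : D a = \sum_i w i * dx i a + \sum_j v j * dy j a.
Proof. by rewrite /koszul_diff -superext_mulE. Qed.

(** The sum runs over all pairs, so that indices can be exchanged freely, unlike in the sums over i
    < j of [cobracket]. *)
Definition quad (I J : finType) (f : I -> J -> k)
    (s : I -> cochain) (t : J -> cochain) : cochain :=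
  \sum_i \sum_j f i j *: (s i * t j).

(** Doubling turns the sums over a < b into sums over all pairs: the coefficient and the product of
    generators change sign together for the x, and are both symmetric for the y, whose diagonal
    terms lose their denominator. *)
Lemma cobracket_edual i : 2%:R *: w i =
  quad (fun a b => edual i [e a, e b]) x x + quad (fun a b => edual i [o a, o b]) y y.
Proof.
rewrite /quad sum_sym => [|a b]; last first.
  rewrite (sbracket_skew_even (ebasis_mem a) (ebasis_mem b)) xgen_anticomm.
  by rewrite scalerN linearN scaleNr opprK.
rewrite sum_sym => [|a b]; last first.
  by rewrite (sbracket_sym_odd (obasis_mem a) (obasis_mem b)) ygenC.
rewrite [X in _ + X + _]big1 ?addr0 => [|a _]; last by rewrite xgen_sqr scaler0.
rewrite cobracketE [X in _ + X + _ + _]big1 ?addr0 => [|a _]; last first.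
  by apply: big1 => b _; rewrite (edual_odd _ (bracket_eo a b)) scale0r.
rewrite -addrA scalerDr scalerDr !scaler_nat; congr (_ + (_ + _)).
rewrite -scaler_nat scaler_sumr; apply: eq_bigr => a _.
by rewrite scalerA mulrC divfK.
Qed.

Lemma cobracket_odual j : v j = quad (fun a b => odual j [e a, o b]) x y.
Proof.
rewrite cobracketE big1 ?add0r => [|a _]; last first.
  by apply: big1 => b _; rewrite (odual_even _ (bracket_ee a b)) scale0r.
rewrite [X in _ + X + _]big1 ?addr0 => [|a _]; last first.
  by apply: big1 => b _; rewrite (odual_even _ (bracket_oo a b)) scale0r.
rewrite [X in _ + X]big1 ?addr0 => [//|a _].
by rewrite (odual_even _ (bracket_oo a a)) mul0r scale0r.
Qed.

Lemma quad_comm (I J : finType) (f : I -> J -> k) s t (c : cochain) :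
  (forall i j, s i * t j * c = c * (s i * t j)) -> quad f s t * c = c * quad f s t.
Proof.
move=> stc; rewrite mulr_suml mulr_sumr; apply: eq_bigr => i _.
rewrite mulr_suml mulr_sumr; apply: eq_bigr => j _.
by rewrite -scalerAl -scalerAr stc.
Qed.

Let anticomm2 (a b c : cochain) : b * c = - (c * b) -> a * c = - (c * a) ->
  a * b * c = c * (a * b).
Proof.
by move=> bc ac; rewrite -[LHS]mulrA bc mulrN [in LHS]mulrA ac mulNr opprK mulrA.
Qed.

Let comm_anticomm (a b c : cochain) : b * c = c * b -> a * c = - (c * a) ->
  a * b * c = - (c * (a * b)).
Proof. by move=> bc ac; rewrite -[LHS]mulrA bc [in LHS]mulrA ac mulNr mulrA. Qed.

Let xgen_ygen i j : x i * y j = - (y j * x i).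
Proof. by rewrite ygen_xgen opprK. Qed.

Lemma comm_xx_x i j l : x i * x j * x l = x l * (x i * x j).
Proof. by apply: anticomm2; apply: xgen_anticomm. Qed.

Lemma comm_xx_y i j l : x i * x j * y l = y l * (x i * x j).
Proof. by apply: anticomm2; apply: xgen_ygen. Qed.

Lemma comm_yy_x i j l : y i * y j * x l = x l * (y i * y j).
Proof. by apply: anticomm2; apply: ygen_xgen. Qed.

Lemma comm_yy_y i j l : y i * y j * y l = y l * (y i * y j).
Proof. by rewrite !ygenM -!sym_inclM mulrC. Qed.

Lemma comm_xy_x i j l : x i * y j * x l = x l * (x i * y j).
Proof. by apply: anticomm2; [apply: ygen_xgen | apply: xgen_anticomm]. Qed.

Lemma anticomm_xy_y i j l : x i * y j * y l = - (y l * (x i * y j)).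
Proof. by apply: comm_anticomm; [apply: ygenC | apply: xgen_ygen]. Qed.

(** Being even and of Z-degree 2, [w i] commutes with every generator; the odd [v j] commutes with
    the x but anticommutes with the y. *)
Lemma cobracket_edual_x i l : w i * x l = x l * w i.
Proof.
apply: scale2_inj; rewrite scalerAl scalerAr cobracket_edual mulrDl mulrDr.
by rewrite !quad_comm // => s t; rewrite ?comm_xx_x ?comm_yy_x.
Qed.

Lemma cobracket_edual_y i l : w i * y l = y l * w i.
Proof.
apply: scale2_inj; rewrite scalerAl scalerAr cobracket_edual mulrDl mulrDr.
by rewrite !quad_comm // => s t; rewrite ?comm_xx_y ?comm_yy_y.
Qed.

Lemma cobracket_odual_x j l : v j * x l = x l * v j.
Proof. by rewrite cobracket_odual quad_comm // => s t; rewrite comm_xy_x. Qed.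

Lemma cobracket_odual_y j l : v j * y l = - (y l * v j).
Proof.
rewrite cobracket_odual mulr_suml mulr_sumr -sumrN; apply: eq_bigr => s _.
rewrite mulr_suml mulr_sumr -sumrN; apply: eq_bigr => t _.
by rewrite -scalerAl -scalerAr anticomm_xy_y scalerN.
Qed.

Lemma koszul_diff_linear : linear D.
Proof.
move=> t a b; rewrite !koszul_diffE scalerDr addrACA; congr (_ + _).
  rewrite scaler_sumr -big_split; apply: eq_bigr => i _.
  by rewrite linearP mulrDr scalerAr.
rewrite scaler_sumr -big_split; apply: eq_bigr => i _.
by rewrite linearP mulrDr scalerAr.
Qed.

HB.instance Definition _ :=
  GRing.isLinear.Build k cochain cochain *:%R D koszul_diff_linear.

Lemma koszul_diff1 : D 1 = 0.
Proof.
rewrite koszul_diffE !big1 ?addr0 // => i _.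
- suff -> : dy i 1 = 0 :> cochain by rewrite mulr0.
  apply/ffunP => S; rewrite dyE superext0 ffunE.
  by case: ifP; rewrite ?mderivC ?mderiv0 scaler0.
- suff -> : dx i 1 = 0 :> cochain by rewrite mulr0.
  apply/ffunP => S; rewrite dxE superext0 ffunE; case: ifP => // _.
  by rewrite finset.setU_eq0 -finset.subset0 finset.sub1set inE andFb scaler0.
Qed.

Let delta_sum (I : finType) (F : I -> cochain) i (b : cochain) :
  \sum_j F j * ((j == i)%:R *: b) = F i * b.
Proof.
rewrite (bigD1 i) //= eqxx scale1r big1 ?addr0 // => j /negPf ->.
by rewrite scale0r mulr0.
Qed.

(** The Kronecker term of [dx_xgenM] produces [w i * b]; in the other terms [x i] passes the
    derivative with a sign and the cobrackets without one. For a y passing the [v j] part, the sign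
    comes from the cobracket instead. *)
Lemma koszul_diff_xgenM i (b : cochain) : D (x i * b) = w i * b - x i * D b.
Proof.
rewrite !koszul_diffE -(delta_sum (fun i => w i) i b) mulrDr opprD addrA !mulr_sumr.
rewrite -!sumrN -big_split /=; congr (_ + _); apply: eq_bigr => j _.
  by rewrite dx_xgenM mulrBr !mulrA cobracket_edual_x.
by rewrite dy_xgenM mulrN !mulrA cobracket_odual_x.
Qed.

Lemma koszul_diff_ygenM j (b : cochain) : D (y j * b) = v j * b - y j * D b.
Proof.
rewrite !koszul_diffE -(delta_sum (fun j => v j) j b) mulrDr opprD addrCA !mulr_sumr.
rewrite -!sumrN -big_split /=; congr (_ + _); apply: eq_bigr => i _.
  by rewrite dx_ygenM mulrN !mulrA cobracket_edual_y.
by rewrite dy_ygenM mulrDr !mulrA cobracket_odual_y mulNr.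
Qed.

(** Used to contract products of structure constants into nested brackets. *)
Lemma edual_sum (f : {linear g -> k | *%R}) z u : z \in g0 ->
  \sum_i f [e i, u] * edual i z = f [z, u].
Proof.
move=> z0; rewrite {2}(edual_decomp z0) sbracket_suml linear_sum.
by apply: eq_bigr => i _; rewrite linearZ mulrC.
Qed.

Lemma odual_sum (f : {linear g -> k | *%R}) z u : z \in g1 ->
  \sum_j f [o j, u] * odual j z = f [z, u].
Proof.
move=> z1; rewrite {2}(odual_decomp z1) sbracket_suml linear_sum.
by apply: eq_bigr => i _; rewrite linearZ mulrC.
Qed.

Lemma quad_sum (I J L : finType) (f : L -> k) (h : L -> I -> J -> k) s t :
  \sum_l f l *: quad (h l) s t = quad (fun i j => \sum_l f l * h l i j) s t.
Proof.
under eq_bigr => l _ do rewrite scaler_sumr.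
rewrite exchange_big; apply: eq_bigr => i _.
under eq_bigr => l _ do rewrite scaler_sumr.
rewrite exchange_big; apply: eq_bigr => j _.
by under eq_bigr => l _ do rewrite scalerA; rewrite -scaler_suml.
Qed.

(** * The Jacobi identity as closedness of the even cobrackets *)

Section Jacobi.
Variable i : 'I_(\dim g0).
Local Notation f := (@edual k g i).

Let edualN z : f (- z) = - f z. Proof. exact: linearN. Qed.
Let edualD u z : f (u + z) = f u + f z. Proof. exact: linearD. Qed.

(** A product of three x is invariant under cyclic permutations and vanishes when an index repeats,
    so [sum_cyclic0] reduces the claim to the Jacobi identity for three even elements. *)
Lemma jacobi_xxx :
  \sum_b \sum_c \sum_d f [[e c, e d], e b] *: (x c * x d * x b) = 0.
Proof.
apply: sum_cyclic0 => [b c d|b c d].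
  have -> : x d * x b * x c = x c * x d * x b by rewrite comm_xx_x mulrA.
  have -> : x b * x c * x d = x c * x d * x b by rewrite -[LHS]mulrA -comm_xx_x.
  rewrite -!scalerDl (sbracket_skew_even (bracket_ee c d) (ebasis_mem b)).
  rewrite (jacobi_even _ (ebasis_mem b) (ebasis_mem c)).
  rewrite (sbracket_skew_even (bracket_ee d b) (ebasis_mem c)).
  rewrite (sbracket_skew_even (ebasis_mem d) (ebasis_mem b)).
  have -> : [e c, - [e b, e d]] = - [e c, [e b, e d]].
    by rewrite -scaleN1r sbracketZr scaleN1r.
  by rewrite opprK edualN edualD opprD addrNK addNr scale0r.
case/or3P => /eqP <-.
- by rewrite comm_xx_x mulrA xgen_sqr mul0r scaler0.
- by rewrite xgen_sqr mul0r scaler0.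
- by rewrite -mulrA xgen_sqr mulr0 scaler0.
Qed.

(** The two copies of the second sum, one of them with c and d exchanged, supply the two terms of
    the Jacobi expansion of [e b, [o c, o d]]. *)
Lemma jacobi_xyy :
  \sum_b \sum_c \sum_d f [[o c, o d], e b] *: (y c * y d * x b)
  + (\sum_d \sum_b \sum_c f [[e b, o c], o d] *: (x b * y c * y d)) *+ 2 = 0.
Proof.
have -> : \sum_d \sum_b \sum_c f [[e b, o c], o d] *: (x b * y c * y d) =
    \sum_b \sum_c \sum_d f [[e b, o c], o d] *: (x b * y c * y d).
  by rewrite exchange_big; apply: eq_bigr => b _; rewrite exchange_big.
rewrite mulr2n addrA -!big_split big1 // => b _ /=.
rewrite [X in _ + X]exchange_big -!big_split big1 // => c _ /=.
rewrite -!big_split big1 // => d _ /=.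
rewrite comm_yy_x mulrA -[x b * y d * y c]mulrA [y d * y c]ygenC mulrA -!scalerDl.
rewrite (sbracket_skew_even (a := false)) ?ebasis_mem ?bracket_oo //.
rewrite (jacobi_even _ (ebasis_mem b) (obasis_mem c)).
rewrite (sbracket_sym_odd (obasis_mem c) (bracket_eo b d)).
rewrite edualN edualD opprD.
by rewrite [X in X + _]addrAC addNr sub0r addNr scale0r.
Qed.

(** The left side is the differential of [2%:R *: w i], expanded by the Leibniz rule from
    [cobracket_edual]. *)
Lemma cobracket_cocycle :
  \sum_a \sum_b f [e a, e b] *: (w a * x b - x a * w b)
  + \sum_a \sum_b f [o a, o b] *: (v a * y b - y a * v b) = 0.
Proof.
(* The two Leibniz terms contribute equally once a and b are exchanged. *)
have sumB (I : finType) (F G : I -> I -> cochain) : (forall a b, G a b = - F b a) ->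
    \sum_a \sum_b (F a b - G a b) = \sum_b ((\sum_a F a b) *+ 2).
  move=> FG; rewrite (eq_bigr (fun a => \sum_b F a b + \sum_b F b a)) => [|a _].
    rewrite big_split /= exchange_big /= -big_split; apply: eq_bigr => b _.
    by rewrite mulr2n.
  by rewrite -big_split; apply: eq_bigr => b _; rewrite FG opprK.
(* Here the resulting factor 2 is spent on [w a], to apply [cobracket_edual]; in the odd sum it
   remains, as [cobracket_odual] has no such factor. Hence the doubled sum in [jacobi_xyy]. *)
have -> : \sum_a \sum_b f [e a, e b] *: (w a * x b - x a * w b) =
    \sum_b (\sum_a f [e a, e b] *: (2%:R *: w a)) * x b.
  under eq_bigr => a _ do under eq_bigr => b _ do rewrite scalerBr.
  rewrite sumB => [|a b]; last first.
    rewrite -cobracket_edual_x // (sbracket_skew_even (ebasis_mem a) (ebasis_mem b)).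
    by rewrite edualN scaleNr.
  apply: eq_bigr => b _; rewrite -sumrMnl mulr_suml; apply: eq_bigr => a _.
  by rewrite -!scalerAl scaler_nat scalerMnr.
have -> : \sum_a \sum_b f [o a, o b] *: (v a * y b - y a * v b) =
    (\sum_b (\sum_a f [o a, o b] *: v a) * y b) *+ 2.
  under eq_bigr => a _ do under eq_bigr => b _ do rewrite scalerBr.
  rewrite sumB => [|a b]; last first.
    rewrite cobracket_odual_y // scalerN opprK.
    by rewrite (sbracket_sym_odd (obasis_mem a) (obasis_mem b)).
  rewrite sumrMnl; congr (_ *+ 2); apply: eq_bigr => b _.
  by rewrite mulr_suml; apply: eq_bigr => a _; rewrite -scalerAl.
under eq_bigr => b _ do
  under eq_bigr => a _ do rewrite cobracket_edual // scalerDr.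
under eq_bigr => b _ do rewrite big_split !quad_sum mulrDl.
rewrite big_split /= -addrA.
have quadE (I J : finType) (h : I -> J -> k) s t (c : cochain) :
    quad h s t * c = \sum_p \sum_q h p q *: (s p * t q * c).
  rewrite mulr_suml; apply: eq_bigr => p _; rewrite mulr_suml.
  by apply: eq_bigr => q _; rewrite -scalerAl.
rewrite [X in X + _](_ : _ = 0) ?add0r; last first.
  rewrite -[RHS]jacobi_xxx; apply: eq_bigr => b _; rewrite quadE.
  apply: eq_bigr => c _; apply: eq_bigr => d _.
  by rewrite (edual_sum f) // bracket_ee.
rewrite -[RHS]jacobi_xyy; congr (_ + _ *+ 2); apply: eq_bigr => b _.
  rewrite quadE; apply: eq_bigr => c _; apply: eq_bigr => d _.
  by rewrite (edual_sum f) // bracket_oo.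
under eq_bigr => a _ do rewrite cobracket_odual.
rewrite quad_sum quadE; apply: eq_bigr => c _; apply: eq_bigr => d _.
by rewrite (odual_sum f) // bracket_eo.
Qed.

(** The Leibniz rule for a closed factor of even Z-degree, obtained by expanding [w i] into
    generators. *)
Lemma koszul_diff_cobracketM (b : cochain) : D (w i * b) = w i * D b.
Proof.
have Dquad (I : finType) (h : I -> I -> k) (s t : I -> cochain) :
    (forall p c, D (s p * c) = t p * c - s p * D c) ->
  D (quad h s s * b) =
    (\sum_p \sum_q h p q *: (t p * s q - s p * t q)) * b + quad h s s * D b.
  move=> Ds; rewrite !mulr_suml linear_sum -big_split; apply: eq_bigr => p _ /=.
  rewrite !mulr_suml linear_sum -big_split; apply: eq_bigr => q _ /=.
  rewrite -!scalerAl linearZ -scalerDr /=; congr (_ *: _).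
  rewrite -[s p * s q * b]mulrA !Ds mulrBr mulrBl opprB.
  by rewrite !mulrA addrA addrAC.
apply: scale2_inj; rewrite scalerAl -linearZ /= scalerAl cobracket_edual //.
rewrite mulrDl linearD /= (Dquad _ _ x (fun a => w a)); last first.
  by move=> p c; apply: koszul_diff_xgenM.
rewrite (Dquad _ _ y (fun a => v a)); last first.
  by move=> p c; apply: koszul_diff_ygenM.
by rewrite addrACA -mulrDl cobracket_cocycle mul0r add0r -mulrDl.
Qed.

Lemma cobracket_edual_pow_boundary r :
  w i ^+ r.+1 = D (x i * w i ^+ r).
Proof.
have Dw0 s : D (w i ^+ s) = 0.
  elim: s => [|s IH]; first by rewrite expr0 koszul_diff1.
  by rewrite exprS koszul_diff_cobracketM IH mulr0.
by rewrite koszul_diff_xgenM // Dw0 mulr0 subr0 exprS.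
Qed.

End Jacobi.
(** The part of [cobracket f] in S^2(g_1^* ), called q in the overview when f is even. *)
Definition square_form (f : g -> k) : {mpoly k[\dim g1]} :=
  \sum_(a < \dim g1) \sum_(b < \dim g1 | (a < b)%N) f [o a, o b] *: ('X_a * 'X_b)
  + \sum_(a < \dim g1) (f [o a, o a] / 2%:R) *: ('X_a * 'X_a).

Lemma square_formE (f : {linear g -> k | *%R}) z : z \in g1 ->
  (square_form f).@[fun j => odual j z] = f [z, z] / 2%:R.
Proof.
move=> z1; apply: (mulIf two_neq0); rewrite divfK //.
have -> : f [z, z] = \sum_a \sum_b f [o a, o b] * (odual a z * odual b z).
  rewrite {1}(odual_decomp z1) sbracket_suml linear_sum; apply: eq_bigr => a _.
  have -> : [o a, z] = \sum_b odual b z *: [o a, o b].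
    by rewrite {1}(odual_decomp z1) sbracket_sumr.
  rewrite linearZ /= linear_sum mulr_sumr; apply: eq_bigr => b _.
  by rewrite linearZ /= mulrCA mulrA mulrC [odual a z * _]mulrC.
rewrite sum_sym => [|a b]; last first.
  by rewrite (sbracket_sym_odd (obasis_mem a) (obasis_mem b)) [odual a z * _]mulrC.
rewrite mevalD mulrDl mulr_natr; congr (_ *+ 2 + _).
  rewrite raddf_sum; apply: eq_bigr => a _; rewrite raddf_sum; apply: eq_bigr => b _.
  by rewrite /= mevalZ mevalM !mevalXU.
rewrite raddf_sum mulr_suml; apply: eq_bigr => a _.
by rewrite /= mevalZ mevalM !mevalXU mulrAC divfK.
Qed.

Lemma cobracket0 (f : g -> k) : cobracket f finset.set0 = square_form f.
Proof.
have x0 (i : 'I_(\dim g0)) : x i finset.set0 = 0.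
  by rewrite ffunE; case: eqP => // /setP/(_ i); rewrite !inE eqxx.
have y0 (j : 'I_(\dim g1)) : y j finset.set0 = 'X_j by rewrite ffunE eqxx.
rewrite cobracketE !superextD !superext_sum.
rewrite [X in X + _ + _ + _]big1 ?add0r => [|a _]; last first.
  rewrite superext_sum big1 // => b _.
  by rewrite superextZ superext_mul0 x0 mul0r scaler0.
rewrite [X in X + _ + _]big1 ?add0r => [|a _]; last first.
  rewrite superext_sum big1 // => b _.
  by rewrite superextZ superext_mul0 x0 mul0r scaler0.
congr (_ + _); apply: eq_bigr => a _.
  rewrite superext_sum; apply: eq_bigr => b _.
  by rewrite superextZ superext_mul0 !y0.
by rewrite superextZ superext_mul0 !y0.
Qed.

Lemma cobracket_edualE i : w i = sym_incl (\dim g0) (square_form (edual i)) +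
  \sum_(a < \dim g0) \sum_(b < \dim g0 | (a < b)%N) edual i [e a, e b] *: (x a * x b).
Proof.
rewrite addrC cobracketE -!addrA; congr (_ + _).
rewrite big1 ?add0r => [|a _]; last first.
  by apply: big1 => b _; rewrite (edual_odd _ (bracket_eo a b)) scale0r.
rewrite sym_inclD !sym_incl_sum; congr (_ + _); apply: eq_bigr => a _.
  by rewrite sym_incl_sum; apply: eq_bigr => b _; rewrite sym_inclZ -ygenM.
by rewrite sym_inclZ -ygenM.
Qed.

Let commZ (c : k) (a b : cochain) : GRing.comm a b -> GRing.comm a (c *: b).
Proof. by rewrite /GRing.comm -scalerAl -scalerAr => ->. Qed.

Lemma cobracket_edual_pchar p i : p \in [pchar k] -> (1 < p)%N ->
  w i ^+ p = sym_incl (\dim g0) (square_form (edual i) ^+ p).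
Proof.
move=> charkp p_gt1; have charp : p \in [pchar cochain] by rewrite pchar_lalg.
have w_sym : GRing.comm (w i) (sym_incl (\dim g0) (square_form (edual i))).
  rewrite sym_inclD !sym_incl_sum; apply: commrD; apply: commr_sum => a _.
    rewrite sym_incl_sum; apply: commr_sum => b _; rewrite sym_inclZ -ygenM.
    by apply/commZ/commrM; apply: cobracket_edual_y.
  by rewrite sym_inclZ -ygenM; apply/commZ/commrM; apply: cobracket_edual_y.
have := cobracket_edualE i; set q := sym_incl _ _; set omega := \sum_a _ => wE.
(* As [w i] commutes with every y, it commutes with q, and so does omega, the difference of the
   two. *)
have q_omega : GRing.comm q omega.
  rewrite (_ : omega = w i - q); first by apply: commrB => //; apply: commr_sym.
  by rewrite wE addrC addKr.
rewrite wE -(pFrobenius_autE charp) pFrobenius_autD_comm // !pFrobenius_autE.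
rewrite sym_inclX -/q [omega ^+ p](_ : _ = 0) ?addr0 // /omega pair_big_dep /=.
apply: sum_expr_pchar_eq0 => // [[a b] [c d]|[a b]] /=.
  apply/commZ/commr_sym/commZ/commrM; apply/commr_sym; rewrite /GRing.comm.
    by rewrite comm_xx_x.
  by rewrite comm_xx_x.
(* As p is at least 2, the power begins with x_a x_b x_a = x_a x_a x_b = 0. *)
case: p p_gt1 {charkp charp} => [|[|p]] // _.
by rewrite exprZn !exprS !mulrA comm_xx_x mulrA xgen_sqr !mul0r scaler0.
Qed.

Lemma coh_class_eq0 (a : cochain) :
  coh_class (g := g) a = coh_class 0 <-> exists c, a = D c.
Proof.
split=> [ac|[c ->]].
  have : coh_class (g := g) a a by exists 0; rewrite subrr linear0.
  by rewrite ac => -[c]; rewrite subr0; exists c.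
apply/seteqP; split=> b [d bd].
  by exists (d + c); rewrite linearD /= -bd subr0 subrK.
by exists (d - c); rewrite linearB /= -bd subr0.
Qed.

Lemma square_form_power_ker p i : p \in [pchar k] -> (1 < p)%N ->
  power_ker p (square_form (@edual k g i)).
Proof.
move=> charkp p_gt1; apply/coh_class_eq0; exists (x i * w i ^+ p.-1).
rewrite -cobracket_edual_pow_boundary // prednK ?(ltnW p_gt1) //.
by rewrite cobracket_edual_pchar.
Qed.

Lemma power_ker_eval p P z : (0 < p)%N -> z \in g1 -> [z, z] = 0 ->
  power_ker (g := g) p P -> P.@[fun j => odual j z] = 0.
Proof.
move=> p_gt0 z1 zz0 /coh_class_eq0[c].
move=> /(congr1 (fun a : cochain => (a finset.set0).@[fun j => odual j z])).
rewrite ffunE eqxx koszul_diffE superextD !superext_sum mevalD !raddf_sum /=.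
(* Each term of the differential has a cobracket as a factor, and by [cobracket0] and [square_formE]
   the value of that factor at z is f([z, z]) / 2 = 0, for even and odd f alike. *)
rewrite !big1 ?addr0 => [|j _|i _]; last 2 first.
- by rewrite superext_mul0 cobracket0 mevalM square_formE // zz0 linear0 mul0r mul0r.
- by rewrite superext_mul0 cobracket0 mevalM square_formE // zz0 linear0 mul0r mul0r.
by rewrite rmorphXn => /eqP; rewrite expf_eq0 p_gt0 => /eqP.
Qed.

(** The square [z, z] is even, so its coordinates [edual i] determine it. *)
Lemma bracket_eq0 z : z \in g1 ->
  (forall i, (square_form (edual i)).@[fun j => odual j z] = 0) -> [z, z] = 0.
Proof.
move=> z1 sq0; have zz0 := sbracket_graded z1 z1.
rewrite (edual_decomp zz0) big1 // => i _.
have /eqP := sq0 i; rewrite square_formE // mulf_eq0 invr_eq0 (negPf two_neq0) orbF.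
by move/eqP ->; rewrite scale0r.
Qed.

End Koszul.

(** * Points and maximal ideals *)

Section MaxIdeal.
Local Open Scope classical_set_scope.
Variables (k : fieldType) (g : lieSuperalgebra k).
Local Notation odd_sym := {mpoly k[\dim (component g true)]}.

Lemma idealr_closed_setP (M : set odd_sym) : idealr_closed (mem M) <->
  [/\ M 0, ~ M 1 & forall a u v, M u -> M v -> M (a * u + v)].
Proof.
split=> [[M0 /negP M1 MD]|[M0 M1 MD]].
  split; [exact: set_mem | by move=> /mem_set | move=> a u v Mu Mv].
  by apply: set_mem; apply: MD; apply: mem_set.
split; [exact: mem_set | by apply/negP => /set_mem | move=> a u v Mu Mv].
by apply: mem_set; apply: MD; apply: set_mem.
Qed.

Lemma max_ideal_prime (M : set odd_sym) : max_ideal M -> prime_ideal M.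
Proof.
move=> [/idealr_closed_setP[M0 M1 MD] Mmax]; split=> // u v Muv.
have [Mu|nMu] := pselect (M u); [by left | right].
have ME m a : M m -> M (a * m) by move=> Mm; rewrite -[_ * _]addr0; apply: MD.
(* Either M + (u) contains 1 = a u + m, and then v = a u v + m v lies in M, or it is proper and
   equals M by maximality, which puts u in M. *)
pose I : set odd_sym := [set t | exists a m, M m /\ t = a * u + m].
have [[a [m [Mm au1]]]|nI1] := pselect (I 1).
  by rewrite -[v]mul1r au1 mulrDl -mulrA; apply: MD => //; rewrite mulrC; apply: ME.
have IM : I = M.
  apply: Mmax => [|m Mm]; last by exists 0, m; rewrite mul0r add0r.
  apply/idealr_closed_setP; split=> //; first by exists 0, 0; rewrite mul0r add0r.
  move=> c _ _ [a [m [Mm ->]]] [a' [m' [Mm' ->]]].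
  exists (c * a + a'), (c * m + m'); split; first exact: MD.
  by rewrite mulrDr mulrDl !mulrA addrACA.
by case: nMu; rewrite -IM; exists 1, 0; rewrite mul1r addr0.
Qed.

Lemma point_ideal_max (z : g) : max_ideal (point_ideal z).
Proof.
split.
  apply/idealr_closed_setP; split; rewrite /point_ideal /= ?meval0 //.
    by rewrite meval1; apply/eqP/oner_neq0.
  by move=> a u v u0 v0; rewrite mevalD mevalM u0 v0 mulr0 addr0.
move=> I /idealr_closed_setP[I0 I1 ID] zI; apply/seteqP; split=> // P IP.
apply: contrapT => /eqP; set c := P.@[_] => c_neq0; apply: I1.
(* P has the value c at z, so the second summand vanishes at z and lies in I. *)
have -> : 1 = (c^-1)%:MP * P + (1 - (c^-1)%:MP * P) by rewrite addrC subrK.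
apply: ID => //; apply: zI; rewrite /point_ideal /= mevalB mevalM meval1 mevalC.
by rewrite -/c mulVf ?subrr.
Qed.

Lemma point_ideal_inj (z u : g) : z \in component g true -> u \in component g true ->
  point_ideal z = point_ideal u -> z = u.
Proof.
move=> z1 u1 zu; rewrite (odual_decomp z1) (odual_decomp u1).
apply: eq_bigr => j _; congr (_ *: _).
have : point_ideal z ('X_j - (odual j z)%:MP).
  by rewrite /point_ideal /= mevalB mevalXU mevalC subrr.
rewrite zu /point_ideal /= mevalB mevalXU mevalC => /eqP.
by rewrite subr_eq0 => /eqP ->.
Qed.

End MaxIdeal.

Local Open Scope classical_set_scope.

Theorem theorem4p2p4 (k : closedFieldType) (p : nat) (g : lieSuperalgebra k)
    (charkp : p \in [pchar k]) (p_ge3 : (3 <= p)%N) :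
  set_bij [set x : g | x \in component g true /\ sbracket x x = 0]
    (cohvar (g := g) p) (@point_ideal k g).
Proof.
have two_neq0 : 2%:R != 0 :> k.
  by rewrite -(dvdn_pcharf charkp) gtnNdvd.
have p_gt1 : (1 < p)%N by apply: ltnW.
split.
- move=> z [z1 zz0]; split; first exact: point_ideal_max.
  by move=> P; apply: power_ker_eval => //; apply: ltnW.
- by move=> z u /set_mem[z1 _] /set_mem[u1 _]; apply: point_ideal_inj.
move=> M [Mmax JM]; have Mprime := max_ideal_prime Mmax.
have [_ nM1 _ _] := Mprime.
(* With b = 1 the theorem just gives a common zero; z is the odd element with these coordinates. *)
have [c Mc _] := nullstellensatz Mprime nM1.
pose z := \sum_j c j *: tnth (obasis g) j.
have z1 : z \in component g true.
  by apply: memv_suml => j _; apply/memvZ/obasis_mem.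
have zc : (fun j => odual j z) = c.
  apply/funext => j; rewrite linear_sum (bigD1 j) //= linearZ /= odual_o eqxx mulr1.
  rewrite big1 ?addr0 // => l lj.
  by rewrite linearZ /= odual_o (negPf lj) mulr0.
have Mz : M `<=` point_ideal z by move=> P MP; rewrite /point_ideal /= zc; apply: Mc.
(* The ideal of z is proper and contains M, so maximality of M makes them equal. *)
exists z; last by have [_] := Mmax; apply=> //; have [] := point_ideal_max z.
split=> //; apply: bracket_eq0 => // i; apply: Mz; apply: JM.
exact: square_form_power_ker.
Qed.
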